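(* Let $X$ and $Y$ be zero-mean random vectors in $\mathbb{C}^n$ (or $\mathbb{R}^n$), representing classes $C_1$ and $C_2$, with positive definite covariance matrices $B=\mathbb{E}[XX^\dagger]$ and $A=\mathbb{E}[YY^\dagger]$ respectively. Let $B=\varphi\Lambda\varphi^\dagger$ be an eigendecomposition of $B$, where the columns $\varphi_1,\dots,\varphi_n$ of $\varphi$ form an orthonormal basis of eigenvectors and $\Lambda=\mathrm{diag}(\lambda_1,\dots,\lambda_n)$ with all $\lambda_k>0$, and let $L=\Lambda^{-1/2}\varphi^\dagger$ be the corresponding whitening operator of class $C_1$. Let $\psi_1,\dots,\psi_n$ be an orthonormal basis (for the standard inner product) and put $\tilde\psi_k=L^\dagger\psi_k$ for $1\le k\le n$. Then $\{\psi_k\}_{1\le k\le n}$ is a Karhunen--Loève basis of the random vector $LY$ if and only if $\{\tilde\psi_k\}_{1\le k\le n}$ is a solution of the matrix pencil equation of $(A,B)$, i.e. for every $k$ there is a scalar $\mu_k$ with $A\tilde\psi_k=\mu_k B\tilde\psi_k$.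
   Context: The symbol $\dagger$ denotes the conjugate transpose and $\mathbb{E}$ the expectation. A Karhunen--Loève (KL) basis of a zero-mean random vector $Z$ is an orthonormal basis (for the standard inner product) consisting of eigenvectors of its covariance matrix $\mathbb{E}[ZZ^\dagger]$; the coefficients of $Z$ in such a basis are uncorrelated. The matrix pencil equation of $(A,B)$ is the generalized eigenvalue problem $Av=\mu Bv$ with characteristic equation $\det(A-\lambda B)=0$; its solutions are nonzero vectors $v$ satisfying $Av=\mu Bv$ for some scalar $\mu$. *)

(* Defs.v *)
From HB Require Import structures.
From mathcomp Require Import all_boot all_order all_algebra.
From mathcomp Require Import complex.
From mathcomp Require Import all_classical all_reals all_analysis.

Set Implicit Arguments.
Unset Strict Implicit.
Unset Printing Implicit Defensive.

Import Order.TTheory GRing.Theory Num.Theory.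
Local Open Scope ring_scope.
Local Open Scope complex_scope.

(* The algebraic notions below are stated over a scalar field K equipped with
   a conjugation cj and an embedding emb of the reals; they are used with
   K = R[i], cj = conjc, emb = real_complex R, and with K = R, cj = emb = id. *)

Definition adjmx (K : numFieldType) (cj : K -> K) (m n : nat)
  (M : 'M[K]_(m, n)) : 'M[K]_(n, m) := map_mx cj M^T.

Definition orthonormal_basis (K : numFieldType) (cj : K -> K) (n : nat)
    (u : 'I_n -> 'cV[K]_n) : Prop :=
  basis_of fullv (codom u) /\
  forall j k, (adjmx cj (u k) *m u j) 0 0 = (j == k)%:R.

(* Over R[i], the comparison 0 < z also says that z is real. *)
Definition posdefmx (K : numFieldType) (cj : K -> K) (n : nat)
    (M : 'M[K]_n) : Prop :=
  adjmx cj M = M /\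
  forall v : 'cV[K]_n, v != 0 -> 0 < (adjmx cj v *m M *m v) 0 0.

Definition eigenvector (K : numFieldType) (n : nat) (M : 'M[K]_n)
    (v : 'cV[K]_n) : Prop :=
  v != 0 /\ exists mu : K, M *m v = mu *: v.

Definition pencil_solution (K : numFieldType) (n : nat) (A B : 'M[K]_n)
    (v : 'cV[K]_n) : Prop :=
  v != 0 /\ exists mu : K, A *m v = mu *: (B *m v).

Definition eigendecomposition (R : realType) (K : numFieldType) (cj : K -> K)
    (emb : R -> K) (n : nat) (B phi : 'M[K]_n) (lam : 'rV[R]_n) : Prop :=
  [/\ orthonormal_basis cj (fun k => col k phi),
      forall k, eigenvector B (col k phi)
    & B = phi *m diag_mx (map_mx emb lam) *m adjmx cj phi].

Definition whitening (R : realType) (K : numFieldType) (cj : K -> K)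
    (emb : R -> K) (n : nat) (phi : 'M[K]_n) (lam : 'rV[R]_n) : 'M[K]_n :=
  diag_mx (\row_k emb (Num.sqrt (lam 0 k))^-1) *m adjmx cj phi.

Section RandomVectors.
Context (d : measure_display) (T : measurableType d) (R : realType)
  (P : probability T R) (n : nat).

Definition meanR (f : T -> R) : R := fine 'E_P[f]%E.

Definition meanC (f : T -> R[i]) : R[i] :=
  meanR (fun w => complex.Re (f w)) +i* meanR (fun w => complex.Im (f w)).

(* Membership in Lfun includes measurability. Square integrability of the
   coordinates makes every entry of the covariance matrix a genuine integral. *)
Definition zero_mean_rvecR (Z : T -> 'cV[R]_n) : Prop :=
  forall j, (fun w => Z w j 0) \in Lfun P 2%:E /\
            meanR (fun w => Z w j 0) = 0.

Definition zero_mean_rvecC (Z : T -> 'cV[R[i]]_n) : Prop :=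
  forall j, [/\ (fun w => complex.Re (Z w j 0)) \in Lfun P 2%:E,
                (fun w => complex.Im (Z w j 0)) \in Lfun P 2%:E
              & meanC (fun w => Z w j 0) = 0].

(* Since the vectors considered have zero mean, the covariance matrix is the
   uncentred second moment, E[Z Z^dagger]. *)
Definition covmxR (Z : T -> 'cV[R]_n) : 'M[R]_n :=
  \matrix_(j, k) meanR (fun w => (Z w *m adjmx id (Z w)) j k).

Definition covmxC (Z : T -> 'cV[R[i]]_n) : 'M[R[i]]_n :=
  \matrix_(j, k) meanC (fun w => (Z w *m adjmx conjc (Z w)) j k).

Definition KL_basisR (Z : T -> 'cV[R]_n) (psi : 'I_n -> 'cV[R]_n) : Prop :=
  [/\ zero_mean_rvecR Z, orthonormal_basis id psi
    & forall k, eigenvector (covmxR Z) (psi k)].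

Definition KL_basisC (Z : T -> 'cV[R[i]]_n)
    (psi : 'I_n -> 'cV[R[i]]_n) : Prop :=
  [/\ zero_mean_rvecC Z, orthonormal_basis conjc psi
    & forall k, eigenvector (covmxC Z) (psi k)].

End RandomVectors.

(* Main.v *)
Require Import Defs.
From HB Require Import structures.
From mathcomp Require Import all_boot all_order all_algebra.
From mathcomp Require Import complex.
From mathcomp Require Import all_classical all_reals all_analysis.

Set Implicit Arguments.
Unset Strict Implicit.
Unset Printing Implicit Defensive.

Import Order.TTheory GRing.Theory Num.Theory.
Local Open Scope ring_scope.
Local Open Scope complex_scope.

(** Write [M^+] for the adjoint of [M].  Orthonormality of the columns of [phi]
    gives [phi^+ *m phi = 1], so the whitening operator satisfies
    [L *m B *m L^+ = 1] ([whitening_congruence]).  Hence [L] and [B *m L^+] are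
    inverse to each other, and multiplying by one or the other turns
    [L *m A *m L^+ *m v = mu *: v] into [A *m (L^+ *m v) = mu *: (B *m (L^+ *m v))]
    and back ([eigenvector_pencil]).

    On the probabilistic side, linearity of the mean gives that [L Y] is again
    centred and square integrable and that its covariance matrix is
    [L *m A *m L^+] ([centred_mulmxl], [covmx_congruence]).  This uses very little of
    integration theory: a mean that is linear on a space of functions
    containing the products [f * cj g] of square integrable functions
    ([linear_mean], [square_integrable]).  The real and the complex mean both
    provide this, so the equivalence is proved once, over an abstract scalar
    field with conjugation ([KL_basis_pencil]). *)

(** * Whitening turns a pencil into an eigenvalue problem *)

Lemma adjmxM (K : numFieldType) (cj : {rmorphism K -> K}) m n p
    (M : 'M[K]_(m, n)) (N : 'M[K]_(n, p)) :
  adjmx cj (M *m N) = adjmx cj N *m adjmx cj M.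
Proof. by rewrite /adjmx trmx_mul map_mxM. Qed.

Lemma adjmxK (K : numFieldType) (cj : K -> K) (cjK : involutive cj) m n
    (M : 'M[K]_(m, n)) : adjmx cj (adjmx cj M) = M.
Proof. by apply/matrixP=> i j; rewrite !mxE cjK. Qed.

Lemma orthonormal_basis_neq0 (K : numFieldType) (cj : K -> K) n
    (u : 'I_n -> 'cV[K]_n) k : orthonormal_basis cj u -> u k != 0.
Proof.
move=> [_ /(_ k k) uk1]; apply/eqP=> uk0.
by move: uk1; rewrite uk0 mulmx0 mxE eqxx => /esym/eqP; rewrite oner_eq0.
Qed.

Lemma adjmx_mul_orthonormal (K : numFieldType) (cj : K -> K) n (phi : 'M[K]_n) :
  orthonormal_basis cj (fun k => col k phi) -> adjmx cj phi *m phi = 1%:M.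
Proof.
move=> [_ orth]; apply/matrixP=> k j; move: (orth j k).
rewrite !mxE eq_sym => <-.
by apply: eq_bigr => a _; rewrite !mxE.
Qed.

(** The two inner factors [phi^+ *m phi] cancel by orthonormality, and three
    diagonal matrices are left, with product 1. *)
Lemma whitening_congruence (R : realType) (K : numFieldType)
    (cj : {rmorphism K -> K}) (emb : {rmorphism R -> K}) n
    (B phi : 'M[K]_n) (lam : 'rV[R]_n) :
  involutive cj -> (forall x, cj (emb x) = emb x) ->
  eigendecomposition cj emb B phi lam -> (forall k, 0 < lam 0 k) ->
  let L := whitening cj emb phi lam in L *m B *m adjmx cj L = 1%:M.
Proof.
move=> cjK cj_emb [orth _ ->] lam_gt0 /=; rewrite /whitening adjmxM adjmxK //.
have phi1 := adjmx_mul_orthonormal orth.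
set W := diag_mx (\row__ _); set D := diag_mx _.
have -> : adjmx cj W = W.
  apply/matrixP=> i j; rewrite !mxE eq_sym.
  by case: eqP => [->|_]; rewrite /= ?mulr1n ?mulr0n ?cj_emb ?rmorph0.
rewrite !mulmxA -(mulmxA W) phi1 mulmx1 -(mulmxA (W *m D)) phi1 mulmx1.
rewrite /W /D !mulmx_diag; apply/matrixP=> i j; rewrite !mxE.
case: eqP => [_|//]; rewrite !mulr1n -!rmorphM.
have lam_neq0 : Num.sqrt (lam 0 i) != 0 by rewrite gt_eqF // sqrtr_gt0.
(* only the middle factor lam is replaced by the square of sqrt lam *)
by rewrite -{2}(sqr_sqrtr (ltW (lam_gt0 i))) expr2 mulrA mulVf // mul1r mulfV //
  rmorph1.
Qed.

(** The hypothesis says that [B] is congruent to the identity through [L] and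
    [L'], so that [B *m L'] inverts [L] and [L *m B] inverts [L']: the pencil
    equation multiplied on the left by [L] is the eigenvalue equation. *)
Lemma eigenvector_pencil (K : numFieldType) n (A B L L' : 'M[K]_n)
    (v : 'cV[K]_n) : L *m B *m L' = 1%:M ->
  eigenvector (L *m A *m L') v <-> pencil_solution A B (L' *m v).
Proof.
move=> LBL'; have BL'L : B *m L' *m L = 1%:M by apply: mulmx1C; rewrite mulmxA.
split=> -[v0 [mu eqv]]; split.
- apply: contra_neq v0 => L'v0.
  by rewrite -[v]mul1mx -LBL' -mulmxA L'v0 mulmx0.
- exists mu; rewrite -[LHS]mul1mx -BL'L -mulmxA.
  by rewrite [L *m _]mulmxA [L *m A *m _]mulmxA eqv -scalemxAr mulmxA.
- by apply: contra_neq v0 => ->; rewrite mulmx0.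
- by exists mu; rewrite -!mulmxA eqv -scalemxAr !mulmxA LBL' mul1mx.
Qed.

(** * Linear images of centred random vectors *)

(** [D] plays the part of the integrable functions. Linearity is only required
    there: an expectation defined as a total function is not linear outside. *)
Record linear_mean (T : Type) (K : numFieldType) (D : (T -> K) -> Prop)
    (E : (T -> K) -> K) : Prop := LinearMean {
  mean_dom0 : D (fun=> 0);
  mean_domP : forall a f g, D f -> D g -> D (fun w => a * f w + g w);
  mean0 : E (fun=> 0) = 0;
  meanP : forall a f g, D f -> D g ->
    E (fun w => a * f w + g w) = a * E f + E g }.

(** [sqintM_dom] is the Cauchy-Schwarz inequality in qualitative form: it is what
    makes the entries of a covariance matrix actual means. *)
Record square_integrable (T : Type) (K : numFieldType) (cj : K -> K)
    (S D : (T -> K) -> Prop) : Prop := SquareIntegrable {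
  sqint0 : S (fun=> 0);
  sqintP : forall a f g, S f -> S g -> S (fun w => a * f w + g w);
  sqint_dom : forall f, S f -> D f;
  sqintM_dom : forall f g, S f -> S g -> D (fun w => f w * cj (g w)) }.

Definition mean_mx (T : Type) (K : numFieldType) (E : (T -> K) -> K) m n
    (M : T -> 'M[K]_(m, n)) : 'M[K]_(m, n) :=
  \matrix_(j, k) E (fun w => M w j k).

Section LinearImages.
Context (T : Type) (K : numFieldType) (cj : {rmorphism K -> K})
  (S D : (T -> K) -> Prop) (E : (T -> K) -> K).
Hypotheses (ED : linear_mean D E) (SD : square_integrable cj S D).

Lemma lin_closed_sum (C : (T -> K) -> Prop) (I : Type) (r : seq I) (c : I -> K)
    (f : I -> T -> K) :
  C (fun=> 0) -> (forall a f g, C f -> C g -> C (fun w => a * f w + g w)) ->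
  (forall i, C (f i)) -> C (fun w => \sum_(i <- r) c i * f i w).
Proof.
move=> C0 CP Cf; elim: r => [|i r IHr].
  by rewrite (_ : (fun w => _) = fun=> 0) //; apply/funext=> w; rewrite big_nil.
rewrite (_ : (fun w => _) =
  fun w => c i * f i w + \sum_(j <- r) c j * f j w); first exact: CP.
by apply/funext=> w; rewrite big_cons.
Qed.

Lemma mean_sum (I : Type) (r : seq I) (c : I -> K) (f : I -> T -> K) :
  (forall i, D (f i)) ->
  E (fun w => \sum_(i <- r) c i * f i w) = \sum_(i <- r) c i * E (f i).
Proof.
case: ED => D0 DP E0 EP Df; elim: r => [|i r IHr].
  rewrite big_nil -E0; congr E; apply/funext=> w.
  by rewrite big_nil.
rewrite big_cons -IHr -EP //; last exact: lin_closed_sum.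
by congr E; apply/funext=> w; rewrite big_cons.
Qed.

Lemma mean_mulmxl m n p (L : 'M[K]_(m, n)) (M : T -> 'M[K]_(n, p)) :
  (forall j k, D (fun w => M w j k)) ->
  mean_mx E (fun w => L *m M w) = L *m mean_mx E M.
Proof.
move=> DM; apply/matrixP=> j k; rewrite !mxE.
under [in RHS]eq_bigr do rewrite mxE.
rewrite -(@mean_sum _ _ _ (fun i w => M w i k)) //.
by congr E; apply/funext=> w; rewrite mxE.
Qed.

Lemma mean_mulmxr m n p (M : T -> 'M[K]_(m, n)) (N : 'M[K]_(n, p)) :
  (forall j k, D (fun w => M w j k)) ->
  mean_mx E (fun w => M w *m N) = mean_mx E M *m N.
Proof.
move=> DM; apply/matrixP=> j k; rewrite !mxE.
under [in RHS]eq_bigr do rewrite mxE mulrC.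
rewrite -(@mean_sum _ _ _ (fun i w => M w j i)) //.
by congr E; apply/funext=> w; rewrite mxE; apply: eq_bigr => i _; rewrite mulrC.
Qed.

(** The first half is needed because a Karhunen-Loeve basis is one of a centred
    square integrable vector: [L Y] has to qualify. *)
Lemma centred_mulmxl n (L : 'M[K]_n) (Z : T -> 'cV[K]_n) :
  (forall j, S (fun w => Z w j 0) /\ E (fun w => Z w j 0) = 0) ->
  forall j, S (fun w => (L *m Z w) j 0) /\ E (fun w => (L *m Z w) j 0) = 0.
Proof.
move=> Z0 j; case: (SD) => S0 SP S_D _; split.
  rewrite (_ : (fun w => _) = fun w => \sum_i L j i * Z w i 0).
    by apply: (@lin_closed_sum _ _ _ _ (fun i w => Z w i 0)) => // i;
      case: (Z0 i).
  by apply/funext=> w; rewrite mxE.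
have DZ i k : D (fun w => Z w i k) by rewrite ord1; apply: S_D; case: (Z0 i).
have /matrixP/(_ j 0) := mean_mulmxl L DZ; rewrite !mxE => ->.
by rewrite big1 // => i _; rewrite mxE (Z0 i).2 mulr0.
Qed.

(** [L Z (L Z)^+ = L (Z Z^+) L^+] pointwise, and constant matrices come out of
    the mean on either side. *)
Lemma covmx_congruence n (L : 'M[K]_n) (Z : T -> 'cV[K]_n) :
  (forall j, S (fun w => Z w j 0)) ->
  mean_mx E (fun w => (L *m Z w) *m adjmx cj (L *m Z w)) =
  L *m mean_mx E (fun w => Z w *m adjmx cj (Z w)) *m adjmx cj L.
Proof.
move=> SZ.
have DZZ j k : D (fun w => (Z w *m adjmx cj (Z w)) j k).
  rewrite (_ : (fun w => _) = fun w => Z w j 0 * cj (Z w k 0)).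
    exact: (sqintM_dom SD).
  by apply/funext=> w; rewrite !mxE big_ord1 !mxE.
rewrite -mulmxA -mean_mulmxr // -mean_mulmxl.
  by congr mean_mx; apply/funext=> w; rewrite adjmxM !mulmxA.
move=> j k; rewrite (_ : (fun w => _) = fun w =>
  \sum_i adjmx cj L i k * (Z w *m adjmx cj (Z w)) j i).
  apply: (@lin_closed_sum _ _ _ _ (fun i w => (Z w *m adjmx cj (Z w)) j i)) => //.
    exact: mean_dom0 ED.
  exact: mean_domP ED.
by apply/funext=> w; rewrite mxE; apply: eq_bigr => i _; rewrite mulrC.
Qed.

Lemma KL_basis_pencil (R : realType) (emb : {rmorphism R -> K}) n
    (B phi : 'M[K]_n) (lam : 'rV[R]_n) (Y : T -> 'cV[K]_n)
    (psi : 'I_n -> 'cV[K]_n) :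
  let L := whitening cj emb phi lam in
  let centred Z := forall j,
    S (fun w => Z w j 0) /\ E (fun w : T => Z w j (0 : 'I_1)) = 0 in
  let cov Z := mean_mx E (fun w => Z w *m adjmx cj (Z w)) in
  involutive cj -> (forall x, cj (emb x) = emb x) ->
  centred Y -> eigendecomposition cj emb B phi lam ->
  (forall k, 0 < lam 0 k) -> orthonormal_basis cj psi ->
  [/\ centred (fun w => L *m Y w), orthonormal_basis cj psi
    & forall k, eigenvector (cov (fun w => L *m Y w)) (psi k)] <->
  (forall k, pencil_solution (cov Y) B (adjmx cj L *m psi k)).
Proof.
move=> L centred cov cjK cj_emb Y0 decB lam_gt0 orth.
have LBL := whitening_congruence cjK cj_emb decB lam_gt0.
rewrite /cov covmx_congruence; last by move=> j; case: (Y0 j).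
split=> [[_ _ eig] k|sol]; first exact/(eigenvector_pencil _ _ LBL).
by split=> // [|k]; [exact: centred_mulmxl |
  exact/(eigenvector_pencil _ _ LBL)].
Qed.
End LinearImages.

(** * The real and the complex mean *)

Section Means.
Context (d : measure_display) (T : measurableType d) (R : realType)
  (P : probability T R).

Lemma Lfun_lin (r : \bar R) (a : R) (f g : T -> R) : (1 <= r)%E ->
  f \in Lfun P r -> g \in Lfun P r -> (fun w => a * f w + g w) \in Lfun P r.
Proof.
by move=> r1 fr gr; have [_ lin] := Lfun_submod_closed P r1; exact: lin.
Qed.

Lemma Lfun_zero (r : \bar R) : (1 <= r)%E -> (fun=> 0 : R) \in Lfun P r.
Proof. by move=> r1; have [] := Lfun_submod_closed P r1. Qed.

Lemma meanR0 : meanR P (fun=> 0) = 0.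
Proof. by rewrite /meanR (expectation_cst P 0). Qed.

Lemma meanR_lin (a : R) (f g : T -> R) : f \in Lfun P 1 -> g \in Lfun P 1 ->
  meanR P (fun w => a * f w + g w) = a * meanR P f + meanR P g.
Proof.
move=> f1 g1; rewrite /meanR.
rewrite (_ : (fun w => _) = (a \o* f) \+ g); last first.
  by apply/funext=> w /=; rewrite mulrC.
rewrite expectationD ?expectationZl //; last exact: Lfun_scale.
by rewrite fineD ?fineM ?fin_numM ?expectation_fin_num.
Qed.

Lemma Lfun2_Lfun1 (f : T -> R) : f \in Lfun P 2%:E -> f \in Lfun P 1.
Proof. by apply: Lfun_subset12; exact: fin_num_measure. Qed.

Lemma linear_meanR : linear_mean (fun f : T -> R => f \in Lfun P 1) (meanR P).
Proof.
split; [exact: Lfun_zero | | exact: meanR0 | exact: meanR_lin].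
by move=> a f g; exact: Lfun_lin.
Qed.

Lemma square_integrableR : square_integrable id
  (fun f : T -> R => f \in Lfun P 2%:E) (fun f => f \in Lfun P 1).
Proof.
have le12 : (1 <= 2%:E :> \bar R)%E by rewrite lee_fin ler1n.
split; [exact: Lfun_zero | | exact: Lfun2_Lfun1 | exact: Lfun2_mul_Lfun1].
by move=> a f g; exact: Lfun_lin.
Qed.

Definition LfunC (r : \bar R) (f : T -> R[i]) : Prop :=
  (fun w => complex.Re (f w)) \in Lfun P r /\
  (fun w => complex.Im (f w)) \in Lfun P r.

(** In [Re_lin] and [Im_lin] the right-hand sides have the shape
    [c * f + (c' * f' + g)], to which closure of a space of real functions under
    [c * f + g], or linearity of the real mean, applies twice. *)
Lemma Re_lin (a x y : R[i]) : complex.Re (a * x + y) =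
  complex.Re a * complex.Re x + (- complex.Im a * complex.Im x + complex.Re y).
Proof. by case: a x y => [a b] [x x'] [y y'] /=; rewrite mulNr addrA. Qed.

Lemma Im_lin (a x y : R[i]) : complex.Im (a * x + y) =
  complex.Re a * complex.Im x + (complex.Im a * complex.Re x + complex.Im y).
Proof. by case: a x y => [a b] [x x'] [y y'] /=; rewrite addrA. Qed.

Lemma LfunC_zero (r : \bar R) : (1 <= r)%E -> LfunC r (fun=> 0).
Proof. by move=> r1; split; exact: Lfun_zero. Qed.

Lemma LfunC_lin (r : \bar R) (a : R[i]) (f g : T -> R[i]) : (1 <= r)%E ->
  LfunC r f -> LfunC r g -> LfunC r (fun w => a * f w + g w).
Proof.
move=> r1 [fRe fIm] [gRe gIm]; split.
  under eq_fun do rewrite Re_lin.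
  by apply: Lfun_lin => //; apply: Lfun_lin.
under eq_fun do rewrite Im_lin.
by apply: Lfun_lin => //; apply: Lfun_lin.
Qed.

Lemma meanC_lin (a : R[i]) (f g : T -> R[i]) : LfunC 1 f -> LfunC 1 g ->
  meanC P (fun w => a * f w + g w) = a * meanC P f + meanC P g.
Proof.
move=> [fRe fIm] [gRe gIm]; rewrite /meanC.
under eq_fun do rewrite Re_lin.
under [X in _ +i* meanR _ X]eq_fun do rewrite Im_lin.
rewrite !meanR_lin ?Lfun_lin //; apply/eqP; rewrite eq_complex.
by rewrite Re_lin Im_lin !eqxx.
Qed.

Lemma linear_meanC : linear_mean (LfunC 1) (meanC P).
Proof.
split; [exact: LfunC_zero | | by rewrite /meanC /= meanR0 | exact: meanC_lin].
by move=> a f g; exact: LfunC_lin.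
Qed.

Lemma square_integrableC : square_integrable conjc (LfunC 2%:E) (LfunC 1).
Proof.
have le12 : (1 <= 2%:E :> \bar R)%E by rewrite lee_fin ler1n.
split; first exact: LfunC_zero.
- by move=> a f g; exact: LfunC_lin.
- by move=> f [fRe fIm]; split; exact: Lfun2_Lfun1.
move=> f g [fRe fIm] [gRe gIm].
(* the coefficients 1 and -1 give the two parts the shape c * f + g *)
have ReE w : complex.Re (f w * conjc (g w)) =
    1 * (complex.Re (f w) * complex.Re (g w)) +
    complex.Im (f w) * complex.Im (g w).
  by case: (f w) (g w) => [x x'] [y y'] /=; rewrite mulrN opprK mul1r.
have ImE w : complex.Im (f w * conjc (g w)) =
    -1 * (complex.Re (f w) * complex.Im (g w)) +
    complex.Im (f w) * complex.Re (g w).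
  by case: (f w) (g w) => [x x'] [y y'] /=; rewrite mulrN mulN1r.
split.
  by under eq_fun do rewrite ReE; apply: Lfun_lin => //; exact: Lfun2_mul_Lfun1.
by under eq_fun do rewrite ImE; apply: Lfun_lin => //; exact: Lfun2_mul_Lfun1.
Qed.

Lemma zero_mean_rvecCP n (Z : T -> 'cV[R[i]]_n) : zero_mean_rvecC P Z <->
  forall j, LfunC 2%:E (fun w => Z w j 0) /\ meanC P (fun w => Z w j 0) = 0.
Proof. by split=> Z0 j; [have [] := Z0 j | have [[]] := Z0 j]. Qed.

End Means.

Unset Implicit Arguments.

Theorem theorem4 (R : realType) (n : nat)
    (d1 d2 : measure_display) (T1 : measurableType d1) (T2 : measurableType d2)
    (P1 : probability T1 R) (P2 : probability T2 R) :
  (forall (X : T1 -> 'cV[R[i]]_n) (Y : T2 -> 'cV[R[i]]_n)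
      (phi : 'M[R[i]]_n) (lam : 'rV[R]_n) (psi : 'I_n -> 'cV[R[i]]_n),
    let B := covmxC P1 X in
    let A := covmxC P2 Y in
    let L := whitening conjc (real_complex R) phi lam in
    zero_mean_rvecC P1 X -> zero_mean_rvecC P2 Y ->
    posdefmx conjc B -> posdefmx conjc A ->
    eigendecomposition conjc (real_complex R) B phi lam ->
    (forall k, 0 < lam 0 k) ->
    orthonormal_basis conjc psi ->
    KL_basisC P2 (fun w => L *m Y w) psi <->
    (forall k, pencil_solution A B (adjmx conjc L *m psi k)))
  /\
  (forall (X : T1 -> 'cV[R]_n) (Y : T2 -> 'cV[R]_n)
      (phi : 'M[R]_n) (lam : 'rV[R]_n) (psi : 'I_n -> 'cV[R]_n),
    let B := covmxR P1 X in
    let A := covmxR P2 Y in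
    let L := whitening id id phi lam in
    zero_mean_rvecR P1 X -> zero_mean_rvecR P2 Y ->
    posdefmx id B -> posdefmx id A ->
    eigendecomposition id id B phi lam ->
    (forall k, 0 < lam 0 k) ->
    orthonormal_basis id psi ->
    KL_basisR P2 (fun w => L *m Y w) psi <->
    (forall k, pencil_solution A B (adjmx id L *m psi k))).
Proof.
split=> X Y phi lam psi B A L _ Y0 _ _ decB lam_gt0 orth.
  have [KL KL'] := KL_basis_pencil (linear_meanC P2) (square_integrableC P2)
    (@conjcK R) (@conjc_real R) (iffLR (zero_mean_rvecCP P2 Y) Y0) decB lam_gt0
    orth.
  split=> [[LY0 _ eig]|/KL' [LY0 _ eig]].
    by apply: KL; split=> //; exact/zero_mean_rvecCP.
  by split=> //; exact/zero_mean_rvecCP.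
exact: (KL_basis_pencil (cj := idfun) (emb := idfun) (linear_meanR P2)
  (square_integrableR P2) (fun=> erefl) (fun=> erefl) Y0 decB lam_gt0 orth).
Qed.
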